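(* If a scalar type spectral $C_0$-semigroup on a complex infinite-dimensional Banach space is eventually compact, then it is immediately compact.
   Context: A scalar type spectral operator in a complex Banach space $X$ is a densely defined closed linear operator $A$ in $X$ for which there is a strongly $\sigma$-additive spectral measure $E_A(\cdot)$ (the resolution of the identity), assigning to Borel subsets of $\mathbb{C}$ bounded projection operators on $X$ (with $E_A(\emptyset)=0$, $E_A(\mathbb{C})=I$, $E_A(\delta\cap\delta')=E_A(\delta)E_A(\delta')$), whose support is the spectrum $\sigma(A)$, and such that $A=\int_{\sigma(A)}\lambda\,dE_A(\lambda)$. Here, for a Borel measurable $F:\sigma(A)\to\mathbb{C}$, $F(A)=\int_{\sigma(A)}F(\lambda)\,dE_A(\lambda)$ is the operator $F(A)f=\lim_{n\to\infty}\int_{\{|F|\le n\}}F(\lambda)\,dE_A(\lambda)f$, with domain all $f\in X$ for which the limit exists. A scalar type spectral $C_0$-semigroup is a $C_0$-semigroup $\{T(t)\}_{t\ge0}$ of scalar type spectral operators generated by a scalar type spectral operator $A$, so that $T(t)=e^{tA}=\int_{\sigma(A)}e^{t\lambda}\,dE_A(\lambda)$, $t\ge0$. A $C_0$-semigroup $\{T(t)\}_{t\ge0}$ is eventually compact if there exists $t_0>0$ such that $T(t_0)$ is compact (and hence $T(t)$ is compact for all $t\ge t_0$); it is immediately compact if $T(t)$ is compact for every $t>0$. *)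

(* Defs.v *)
From HB Require Import structures.
From mathcomp Require Import all_boot all_order all_algebra complex.
From mathcomp Require Import all_classical all_reals all_analysis.

Set Implicit Arguments.
Unset Strict Implicit.
Unset Printing Implicit Defensive.

Import Order.TTheory GRing.Theory Num.Theory.
Import numFieldNormedType.Exports.

Local Open Scope classical_set_scope.
Local Open Scope ring_scope.
Local Open Scope complex_scope.

(* The topology of the complex plane lives on the alias R[i]^o. *)
Definition complex_borel (R : realType) : set (set R[i]) :=
  <<s (@open R[i]^o) >>.

Section Operators.
Context {R : realType} {X : completeNormedModType R[i]}.

Definition finite_dimensional : Prop :=
  exists (n : nat) (b : 'I_n -> X),
    forall f : X, exists c : 'I_n -> R[i], f = \sum_(i < n) c i *: b i.

Definition bounded_operator (B : X -> X) : Prop := linear B /\ continuous B.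

Definition compact_operator (B : X -> X) : Prop :=
  bounded_operator B /\ compact (closure (B @` [set f : X | `|f| <= 1])).

(* A possibly unbounded operator is given by its domain D and a function A,
   whose values outside D are irrelevant. *)
Definition linear_on (D : set X) (A : X -> X) : Prop :=
  D 0 /\
  forall (a : R[i]) (f g : X), D f -> D g ->
    D (a *: f + g) /\ A (a *: f + g) = a *: A f + A g.

Definition closed_operator (D : set X) (A : X -> X) : Prop :=
  closed [set p : X * X | D p.1 /\ p.2 = A p.1].

Definition resolvent_set (D : set X) (A : X -> X) : set R[i] :=
  [set z | exists B : X -> X,
    [/\ bounded_operator B,
        forall f, D (B f) /\ A (B f) - z *: B f = f &
        forall f, D f -> B (A f - z *: f) = f]].

Definition spectrum (D : set X) (A : X -> X) : set R[i] :=
  ~` resolvent_set D A.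

(* E is only meaningful on Borel sets; each E delta is a projection by the
   multiplicativity clause. *)
Definition spectral_measure (E : set R[i] -> X -> X) : Prop :=
  [/\ forall delta, complex_borel delta -> bounded_operator (E delta),
      forall f, E set0 f = 0,
      forall f, E setT f = f,
      forall delta delta', complex_borel delta -> complex_borel delta' ->
        forall f, E (delta `&` delta') f = E delta (E delta' f) &
      forall delta : nat -> set R[i],
        (forall n, complex_borel (delta n)) -> trivIset setT delta ->
        forall f, series (fun n => E (delta n) f) @ \oo
                    --> E (\bigcup_n delta n) f].

Definition measure_support (E : set R[i] -> X -> X) : set R[i] :=
  [set z | forall U : set R[i]^o, open U -> U z -> exists f, E U f != 0].

(* B is the integral over S of the bounded Borel function F: F is on S a
   uniform limit of Borel simple functions \sum_i c i * 1_(delta i), and B is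
   the limit in operator norm of their integrals \sum_i c i *: E (delta i). *)
Definition is_bounded_integral (E : set R[i] -> X -> X) (S : set R[i])
    (F : R[i] -> R[i]) (B : X -> X) : Prop :=
  bounded_operator B /\
  forall eps : R, 0 < eps ->
    exists (n : nat) (c : 'I_n -> R[i]) (delta : 'I_n -> set R[i]),
      [/\ forall i, complex_borel (delta i),
          trivIset setT delta,
          \bigcup_i delta i = S,
          forall i z, delta i z -> `|F z - c i| <= eps%:C &
          forall f, `|\sum_(i < n) c i *: E (delta i) f - B f|
                      <= eps%:C * `|f|].

(* f is in the domain of \int_S F dE, and g is its image. *)
Definition is_integral (E : set R[i] -> X -> X) (S : set R[i])
    (F : R[i] -> R[i]) (f g : X) : Prop :=
  exists B : nat -> X -> X,
    (forall n, is_bounded_integral E [set z | S z /\ `|F z| <= n%:R] F (B n))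
    /\ B n f @[n --> \oo] --> g.

Definition resolution_of_identity (D : set X) (A : X -> X)
    (E : set R[i] -> X -> X) : Prop :=
  [/\ spectral_measure E,
      measure_support E = spectrum D A,
      forall f, D f <-> exists g, is_integral E (spectrum D A) id f g &
      forall f, D f -> is_integral E (spectrum D A) id f (A f)].

Definition scalar_type_spectral (D : set X) (A : X -> X) : Prop :=
  [/\ linear_on D A, dense D, closed_operator D A &
      exists E : set R[i] -> X -> X, resolution_of_identity D A E].

(* A semigroup is a function on R of which only the values at t >= 0 matter. *)
Definition C0_semigroup (T : R -> X -> X) : Prop :=
  [/\ forall t : R, 0 <= t -> bounded_operator (T t),
      forall f, T 0 f = f,
      forall s t : R, 0 <= s -> 0 <= t -> forall f, T (s + t) f = T s (T t f) &
      forall f, T t f @[t --> 0^'+] --> f].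

Definition difference_quotient (T : R -> X -> X) (f : X) (h : R) : X :=
  (h^-1)%:C *: (T h f - f).

Definition generator_domain (T : R -> X -> X) : set X :=
  [set f | cvg (difference_quotient T f h @[h --> 0^'+])].

Definition generator (T : R -> X -> X) (f : X) : X :=
  lim (difference_quotient T f h @[h --> 0^'+]).

(* The formula T t = \int exp(t z) dE(z), E being the resolution of the
   identity of the generator, is a consequence and is not assumed. *)
Definition scalar_type_spectral_semigroup (T : R -> X -> X) : Prop :=
  [/\ C0_semigroup T,
      scalar_type_spectral (generator_domain T) (generator T) &
      forall t : R, 0 <= t -> scalar_type_spectral setT (T t)].

Definition eventually_compact (T : R -> X -> X) : Prop :=
  exists2 t0 : R, 0 < t0 & compact_operator (T t0).

Definition immediately_compact (T : R -> X -> X) : Prop :=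
  forall t : R, 0 < t -> compact_operator (T t).

End Operators.

Arguments finite_dimensional {R} X.

(* Main.v *)
(* Only the semigroup law and the spectral measure of each T(s) matter: it is
   enough to see that T(s) is compact as soon as T(2s) = T(s)^2 is, since halving
   t0 repeatedly then gives compact T(s) with s arbitrarily small.

   Let S be the integral of the identity against E.  The measure E is uniformly
   bounded, by M say, so a simple operator with coefficients of modulus at most K
   has norm at most 4MK.  Splitting S at modulus e, the small part has norm at most
   4Me and the large part is S^2 composed with the integral of 1/z, whence, for some
   constant C,
     |S f| <= C e |f| + (C/e) |S^2 f|   for all e > 0.
   Hence S is totally bounded on the unit ball when S^2 is. *)
From HB Require Import structures.
Require Import Defs.
From mathcomp Require Import all_boot all_order all_algebra complex.
From mathcomp Require Import all_classical all_reals all_analysis.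
From mathcomp Require Import lra ring.

Set Implicit Arguments.
Unset Strict Implicit.
Unset Printing Implicit Defensive.

Import Order.TTheory GRing.Theory Num.Theory.
Import numFieldNormedType.Exports.

Local Open Scope classical_set_scope.
Local Open Scope ring_scope.
Local Open Scope complex_scope.

(** * Norms and bounded operators *)

Section RealNorm.
Context {R : realType} {X : completeNormedModType R[i]}.
Implicit Types (f g : X) (a : R) (c : R[i]).

(* The norm of a module over [R[i]] takes values in [R[i]]; [rnorm] is the same
   norm valued in [R], where the order is total and [lra] applies. *)
Definition rnorm {V : normedZmodType R[i]} (v : V) : R := complex.Re `|v|.

Lemma rnormE {V : normedZmodType R[i]} (v : V) : `|v| = (rnorm v)%:C.
Proof. by rewrite [RHS]RRe_real ?normr_real. Qed.

Lemma rnorm_le {V : normedZmodType R[i]} (v : V) a : (`|v| <= a%:C) = (rnorm v <= a).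
Proof. by rewrite rnormE lecR. Qed.

Lemma rnorm_lt {V : normedZmodType R[i]} (v : V) a : (`|v| < a%:C) = (rnorm v < a).
Proof. by rewrite rnormE ltcR. Qed.

Lemma rnorm_ge0 {V : normedZmodType R[i]} (v : V) : 0 <= rnorm v.
Proof. by rewrite -ler0c -rnormE. Qed.

Lemma rnorm0 {V : normedZmodType R[i]} : rnorm (0 : V) = 0.
Proof. by apply: complexI; rewrite -rnormE normr0. Qed.

Lemma rnormN {V : normedZmodType R[i]} (v : V) : rnorm (- v) = rnorm v.
Proof. by rewrite /rnorm normrN. Qed.

Lemma rnormBC {V : normedZmodType R[i]} (v w : V) : rnorm (v - w) = rnorm (w - v).
Proof. by rewrite /rnorm distrC. Qed.

Lemma rnormD {V : normedZmodType R[i]} (v w : V) : rnorm (v + w) <= rnorm v + rnorm w.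
Proof. by rewrite -lecR rmorphD/= -!rnormE ler_normD. Qed.

Lemma rnormB {V : normedZmodType R[i]} (v w : V) : rnorm (v - w) <= rnorm v + rnorm w.
Proof. by rewrite -(rnormN w) rnormD. Qed.

Lemma rnorm_dist {V : normedZmodType R[i]} (u v w : V) :
  rnorm (u - w) <= rnorm (u - v) + rnorm (v - w).
Proof. by rewrite -[u - w](subrKA v) rnormD. Qed.

Lemma rnormZ c f : rnorm (c *: f) = rnorm c * rnorm f.
Proof. by apply: complexI; rewrite rmorphM/= -!rnormE normrZ. Qed.

Lemma rnorm_real a : rnorm a%:C = `|a|.
Proof. by apply: complexI; rewrite -rnormE normc_def/= expr0n addr0 sqrtr_sqr. Qed.

Lemma rnormV c : rnorm c^-1 = (rnorm c)^-1.
Proof. by apply: complexI; rewrite fmorphV/= -!rnormE normfV. Qed.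

Lemma gt0_complex (e : R[i]) : 0 < e -> exists2 a : R, 0 < a & e = a%:C.
Proof.
move=> e0; exists (complex.Re e); last by rewrite RRe_real// gtr0_real.
by rewrite -ltcR RRe_real// gtr0_real.
Qed.

Lemma cvg_rnorm (u : nat -> X) f :
  u n @[n --> \oo] --> f <->
  forall a, 0 < a -> \forall n \near \oo, rnorm (f - u n) < a.
Proof.
split=> [/cvgrPdist_lt uf a a0|uf].
  have /uf : 0 < a%:C by rewrite ltcR.
  by apply: filterS => n; rewrite rnorm_lt.
apply/cvgrPdist_lt => _ /gt0_complex[a a0 ->].
by apply: filterS (uf _ a0) => n; rewrite rnorm_lt.
Qed.

Lemma bounded_operator_linear (B : X -> X) :
  bounded_operator B -> exists2 L : {linear X -> X}, B = L & continuous L.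
Proof.
move=> [linB cB].
pose L : {linear X -> X} := HB.pack B (GRing.isLinear.Build _ _ _ _ B linB).
by exists L.
Qed.

Lemma bounded_operatorP (B : X -> X) :
  bounded_operator B -> exists2 K : R, 0 < K & forall f, rnorm (B f) <= K * rnorm f.
Proof.
move=> /bounded_operator_linear[L -> /linear_bounded_continuous/linear_boundedP].
move=> /pinfty_ex_gt0[_ /gt0_complex[K K0 ->]] BK.
exists K => // f; have := BK f.
by rewrite [X in X <= _]rnormE [X in _ * X]rnormE -rmorphM lecR.
Qed.

Lemma bounded_operatorB (B : X -> X) f g : bounded_operator B -> B (f - g) = B f - B g.
Proof. by move=> /bounded_operator_linear[L -> _]; rewrite raddfB. Qed.

Lemma bounded_operatorZ (B : X -> X) c f : bounded_operator B -> B (c *: f) = c *: B f.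
Proof. by move=> /bounded_operator_linear[L -> _]; rewrite linearZ. Qed.

Lemma bounded_operator_sum (B : X -> X) (I : Type) (s : seq I) (P : pred I) (u : I -> X) :
  bounded_operator B -> B (\sum_(i <- s | P i) u i) = \sum_(i <- s | P i) B (u i).
Proof. by move=> /bounded_operator_linear[L -> _]; rewrite raddf_sum. Qed.

(** Lets an approximation error of order [e] tend to 0; the restriction [e <= 1] allows quadratic
    error terms to be bounded by linear ones. *)
Lemma le_eps0 (a K : R) : (forall e : R, 0 < e -> e <= 1 -> a <= e * K) -> a <= 0.
Proof.
move=> aK; rewrite leNgt; apply/negP => a0.
have K0 : 0 < K by have := aK 1 ltr01 (lexx _); lra.
(* With this [e], [e * K] stays below [a / 2], against [a <= e * K]. *)
have e0 : 0 < a / (2 * (K + a)) by rewrite divr_gt0// ; lra.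
have e1 : a / (2 * (K + a)) <= 1 by rewrite ler_pdivrMr; lra.
have := aK _ e0 e1; rewrite mulrAC ler_pdivlMr; last lra.
by nra.
Qed.

(** The third hypothesis nests the closed balls of centre [x n] and radius [r n]. As the radii tend
    to 0 the centres are Cauchy, and completeness gives a common point. *)
Lemma nested_balls (x : nat -> X) (r : nat -> R) :
  (forall n, 0 < r n) -> (forall n, r n <= n.+1%:R^-1) ->
  (forall n, rnorm (x n.+1 - x n) + r n.+1 <= r n) ->
  exists y, forall n, rnorm (y - x n) <= r n.
Proof.
move=> r0 rn xr.
have xk n k : rnorm (x (n + k)%N - x n) + r (n + k)%N <= r n.
  elim: k => [|k IH]; first by rewrite addn0 subrr rnorm0 add0r.
  have := rnorm_dist (x (n + k.+1)%N) (x (n + k)%N) (x n).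
  by have := xr (n + k)%N; rewrite addnS; lra.
have xm n m : (n <= m)%N -> rnorm (x m - x n) <= r n.
  move=> nm; have := xk n (m - n)%N; rewrite subnKC//.
  by have := r0 m; lra.
have : cvgn x.
  apply/cauchy_cvgP/cauchy_ballP => _ /gt0_complex[e e0 ->].
  have e20 : 0 < e / 2 by lra.
  have [N _ HN] := near_infty_natSinv_lt (PosNum e20).
  near_simpl.
  exists ([set n | (N <= n)%N], [set n | (N <= n)%N]) => /=.
    by split; exists N.
  move=> [n m] [/= Nn Nm]; rewrite -ball_normE/= rnorm_lt.
  have := rnorm_dist (x n) (x N) (x m).
  have := xm _ _ Nn; have := xm _ _ Nm; have := rn N.
  have := HN N (leqnn _); rewrite /= (rnormBC (x N)).
  by move: (N.+1%:R^-1) => q; lra.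
move=> /cvg_ex[y xy]; exists y => n.
apply: le_trans (lexx (r n)); rewrite -subr_le0.
apply: (@le_eps0 _ 1) => e e0 _.
have /cvg_rnorm/(_ _ e0)[N _ HN] := xy.
have := HN (maxn N n) (leq_maxl _ _).
have := xm n (maxn N n) (leq_maxr _ _).
have := rnorm_dist y (x (maxn N n)) (x n).
rewrite /=; lra.
Qed.

End RealNorm.
(** * Uniform boundedness principle *)

Section UniformBoundedness.
Context {R : realType} {X : completeNormedModType R[i]}.

(** Otherwise there are nested balls such that on the one built at stage [n] some member of [F]
    exceeds [n] in norm; [F] is then unbounded at their common point. *)
Lemma uniform_boundedness (F : set (X -> X)) :
  (forall B, F B -> bounded_operator B) ->
  (forall f, exists K : R, forall B, F B -> rnorm (B f) <= K) ->
  exists K : R, forall B, F B -> forall f, rnorm (B f) <= K * rnorm f.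
Proof.
move=> Fb Fpt; apply: contrapT => Funb.
have {}Funb K : exists B f, F B /\ K * rnorm f < rnorm (B f).
  apply: contrapT => nK; apply: Funb; exists K => B FB f.
  by rewrite leNgt; apply/negP => ?; apply: nK; exists B, f.
(* The positivity of the radius sits under the existential so that [choice] yields a total function;
   for other radii the witness is arbitrary. *)
have step (n : nat) (p : X * R) : exists q : X * R, 0 < p.2 ->
    [/\ 0 < q.2, q.2 <= n.+2%:R^-1, rnorm (q.1 - p.1) + q.2 <= p.2 &
      exists2 B, F B & forall y, rnorm (y - q.1) <= q.2 -> n%:R < rnorm (B y)].
  case: p => x r /=; have [r0|] := ltP 0 r; last by exists (x, r).
  have [K0 FK0] := Fpt x.
  (* The factor is chosen so that rescaling [f] to norm [r / 2] makes its image larger than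
     [n + 1 + |K0|]. *)
  have [B [f [FB Bf]]] := Funb (2 * (n%:R + 1 + `|K0|) / r).
  have BB := Fb _ FB; have [K K_gt0 BK] := bounded_operatorP BB.
  have f0 : 0 < rnorm f.
    rewrite lt_neqAle rnorm_ge0 andbT; apply/eqP => f0.
    by have := BK f; move: Bf; rewrite -f0 !mulr0; lra.
  pose h := (r / 2 / rnorm f)%:C *: f.
  have t0 : 0 < r / 2 / rnorm f by rewrite !divr_gt0.
  have hr : rnorm h = r / 2 by rewrite rnormZ rnorm_real gtr0_norm// divfK ?gt_eqF.
  have Bh : n%:R + 1 + `|K0| < rnorm (B h).
    rewrite bounded_operatorZ// rnormZ rnorm_real (gtr0_norm t0).
    rewrite -(ltr_pM2l t0) in Bf; apply: le_lt_trans Bf.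
    rewrite le_eqVlt; apply/orP; left; apply/eqP; field.
    by rewrite !gt_eqF.
  have Bxh : n%:R + 1 < rnorm (B (x + h)).
    have := rnormB (B (x + h)) (B x); rewrite -bounded_operatorB// addrAC subrr add0r.
    by have := FK0 _ FB; have := ler_norm K0; lra.
  (* [r / 2] keeps the new ball inside the old one, [n.+2%:R^-1] drives the radii to 0, and [K^-1]
     lets [B] vary by at most 1 on the new ball. *)
  exists (x + h, Num.min (r / 2) (Num.min n.+2%:R^-1 K^-1)) => _ /=; split.
  - by rewrite !lt_min !invr_gt0 ltr0n K_gt0 divr_gt0.
  - by rewrite ge_min ge_min lexx orbT.
  - rewrite addrAC subrr add0r hr.
    have : Num.min (r / 2) (Num.min n.+2%:R^-1 K^-1) <= r / 2 by rewrite ge_min lexx.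
    by lra.
  - exists B => // y; rewrite !le_min => /and3P[_ _ yK].
    have := BK (y - (x + h)); rewrite bounded_operatorB//.
    have : K * rnorm (y - (x + h)) <= 1.
      by rewrite -ler_pdivlMl// mulr1.
    have := rnormB (B y) (B y - B (x + h)); rewrite subKr.
    lra.
have [g gP] := choice (fun np : nat * (X * R) => step np.1 np.2).
pose s := fix s n := if n is m.+1 then g (m, s m) else (0, 1).
have s0 n : 0 < (s n).2.
  by elim: n => [|n IH]//=; have [] := gP (n, s n) IH.
have sr n : (s n).2 <= n.+1%:R^-1.
  by case: n => [|n] /=; [rewrite invr1|have [] := gP (n, s n) (s0 n)].
have sxr n : rnorm ((s n.+1).1 - (s n).1) + (s n.+1).2 <= (s n).2.
  by have [] := gP (n, s n) (s0 n).
have [y ys] := nested_balls (x := fst \o s) (r := snd \o s) s0 sr sxr.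
have [K FK] := Fpt y.
have Kn := le_lt_trans (ler_norm K) (archi_boundP (normr_ge0 K)).
set n := Num.bound _ in Kn.
have [_ _ _ [B FB nB]] := gP (n, s n) (s0 n).
by have := nB y (ys n.+1); have := FK _ FB; move: Kn; rewrite /=; lra.
Qed.

End UniformBoundedness.
(** * Boundedness of spectral measures *)

Section Borel.
Context {R : realType}.
Implicit Types A B : set R[i].

Let complex_borelE : @complex_borel R = @measurable _ (g_sigma_algebraType (@open R[i]^o)).
Proof. by []. Qed.

Lemma complex_borel0 : @complex_borel R set0.
Proof. exact: sigma_algebra0. Qed.

Lemma complex_borelT : @complex_borel R setT.
Proof. by rewrite complex_borelE; exact: measurableT. Qed.

Lemma complex_borelI A B : complex_borel A -> complex_borel B -> complex_borel (A `&` B).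
Proof. by rewrite complex_borelE; exact: measurableI. Qed.

Lemma complex_borelD A B : complex_borel A -> complex_borel B -> complex_borel (A `\` B).
Proof. by rewrite complex_borelE; exact: measurableD. Qed.

Lemma complex_borel_bigsetU (I : Type) (s : seq I) (P : pred I) (delta : I -> set R[i]) :
  (forall i, complex_borel (delta i)) ->
  complex_borel (\big[setU/set0]_(i <- s | P i) delta i).
Proof. by move=> db; rewrite complex_borelE; apply: bigsetU_measurable => i _; exact: db. Qed.

End Borel.
Section SpectralMeasure.
Context {R : realType} {X : completeNormedModType R[i]}.
Variable E : set R[i] -> X -> X.
Hypothesis Esm : spectral_measure E.
Implicit Types (A B : set R[i]) (f : X).

(** Countable additivity along [bigcup2 A B], whose terms are empty from index 2 on, so that the
    series is eventually constant. *)
Lemma spectral_measure_setU A B f :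
  complex_borel A -> complex_borel B -> A `&` B = set0 ->
  E (A `|` B) f = E A f + E B f.
Proof.
move: Esm => [_ E0 _ _ Es] bA bB; rewrite trivIset_bigcup2 => AB.
have bAB n : complex_borel (bigcup2 A B n).
  by case: n => [//|[//|n]]; exact: complex_borel0.
have := Es _ bAB AB f; rewrite bigcup2E => cE.
suff cE' : series (fun n => E (bigcup2 A B n) f) @ \oo --> E A f + E B f.
  exact: norm_cvg_unique cE cE'.
apply/cvgrPdist_lt => e e0; exists 2%N => // -[//|[//|n]] _.
rewrite /series/= big_nat_recl// big_nat_recl//= big1 ?addr0 ?subrr ?normr0//.
Qed.

Lemma spectral_measure_bigsetU (I : finType) (P : pred I) (delta : I -> set R[i]) f :
  (forall i, complex_borel (delta i)) -> trivIset setT delta ->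
  E (\big[setU/set0]_(i | P i) delta i) f = \sum_(i | P i) E (delta i) f.
Proof.
move=> bd dd; rewrite -big_filter -[RHS]big_filter.
have : uniq [seq i <- index_enum I | P i] by rewrite filter_uniq// index_enum_uniq.
elim: [seq i <- index_enum I | P i] => [|i s IH].
  by have [_ E0 _ _ _] := Esm; rewrite !big_nil E0.
move=> /andP[Ni us].
rewrite !big_cons spectral_measure_setU ?IH//; first exact: complex_borel_bigsetU.
rewrite -bigcup_seq; apply/seteqP; split => // z [iz [j /= js jz]].
suff ij : i = j by rewrite ij js in Ni.
by apply: dd => //; exists z.
Qed.

Lemma spectral_measure_cover (I : finType) (delta : I -> set R[i]) A f :
  complex_borel A -> (forall i, complex_borel (delta i)) -> trivIset setT delta ->
  A `<=` \bigcup_i delta i ->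
  E A f = \sum_i E (A `&` delta i) f.
Proof.
move=> bA bd dd Ad.
rewrite -spectral_measure_bigsetU; last 2 first.
- by move=> i; exact: complex_borelI.
- exact: trivIset_setIl.
congr (E _ f); apply/seteqP; split=> z.
  move=> Az; have [i _ iz] := Ad _ Az.
  by rewrite -bigcup_seq; exists i => //=; rewrite mem_index_enum.
by rewrite -bigcup_seq => -[i _ []].
Qed.

(** The terms of a convergent series are bounded, so the operators [E (gamma n)] are pointwise
    bounded and uniform boundedness applies. *)
Lemma spectral_measure_disjoint_bounded (gamma : nat -> set R[i]) :
  (forall n, complex_borel (gamma n)) -> trivIset setT gamma ->
  exists K : R, forall n f, rnorm (E (gamma n) f) <= K * rnorm f.
Proof.
move: Esm => [Eb _ _ _ Es] bg dg.
have [||K EK] := @uniform_boundedness _ _ (range (E \o gamma)).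
- by move=> _ [n _ <-]; exact: Eb.
- move=> f; have /cvg_rnorm/(_ _ ltr01)[N _ HN] := Es _ bg dg f.
  (* Terms before [N] occur in the sum; a later term is the difference of two remainders of norm
     below 1. *)
  exists (2 + \sum_(i < N) rnorm (E (gamma i) f)) => _ [n _ <-] /=.
  have sum0 (P : pred 'I_N) : 0 <= \sum_(i < N | P i) rnorm (E (gamma i) f).
    by apply: sumr_ge0 => i _; exact: rnorm_ge0.
  have [Nn|nN] := leqP N n; last first.
    by rewrite (bigD1 (Ordinal nN))//=; have := sum0 (predC1 (Ordinal nN)); lra.
  have := HN n Nn; have := HN n.+1 (leqW Nn).
  rewrite /series/= big_nat_recr//=.
  set l := E _ f; set s := \sum_(_ <= _ < _) _ => l1 l2.
  have -> : E (gamma n) f = (l - s) - (l - (s + E (gamma n) f)).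
    by rewrite addrC opprB addrA subrK addrAC subrr add0r.
  have := rnormB (l - s) (l - (s + E (gamma n) f)); have := sum0 predT; lra.
by exists K => n f; apply: EK; exists n.
Qed.

Let bounded_inside A := exists K : R, forall B, complex_borel B -> B `<=` A ->
  forall f, rnorm (E B f) <= K * rnorm f.

Let split_unbounded (n : nat) A :
  exists BC : set R[i] * set R[i], complex_borel A -> ~ bounded_inside A ->
    [/\ complex_borel BC.1 /\ complex_borel BC.2, ~ bounded_inside BC.2,
        BC.1 `<=` A /\ BC.2 `<=` A, BC.1 `&` BC.2 = set0 &
        exists f, n%:R * rnorm f < rnorm (E BC.1 f)].
Proof.
have [bA|] := pselect (complex_borel A); last by exists (A, A).
have [|uA] := pselect (bounded_inside A); first by exists (A, A).
have [Eb _ _ _ _] := Esm.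
have [K K0 AK] := bounded_operatorP (Eb _ bA).
(* [K] bounds [E A], so the threshold [n + K] makes [E] exceed [n] at [f] on [A \ B] as well as on
   [B]. Either piece can thus serve as the large one. *)
have [B [bB BA [f Bf]]] : exists B, [/\ complex_borel B, B `<=` A &
    exists f, (n%:R + K) * rnorm f < rnorm (E B f)].
  apply: contrapT => nB; apply: uA; exists (n%:R + K) => B bB BA f.
  by rewrite leNgt; apply/negP => Bf; apply: nB; exists B; split=> //; exists f.
have bAB := complex_borelD bA bB.
have EA g C : complex_borel C -> C `<=` A ->
    E C g = E (C `&` B) g + E (C `&` (A `\` B)) g.
  move=> bC CA; rewrite -spectral_measure_setU; try exact: complex_borelI.
    by rewrite -setIUr setDUK// (setIidl CA).
  by rewrite setIACA setDE (setICA B) setICr !setI0.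
have Bf' : n%:R * rnorm f < rnorm (E B f).
  by apply: le_lt_trans Bf; rewrite ler_wpM2r ?rnorm_ge0//; lra.
(* If [E] is bounded inside [B], it cannot be so inside [A \ B], since the bounds would add up to
   one inside [A]. Otherwise [B] itself is the piece to split further. *)
have [uB|vB] := pselect (bounded_inside B).
- exists (B, A `\` B) => _ _ /=; split=> //.
  + move=> [K2 HK2]; have [K1 HK1] := uB; apply: uA; exists (K1 + K2) => C bC CA g.
    rewrite (EA g C)// mulrDl; apply: le_trans (rnormD _ _) _; apply: lerD.
      by apply: HK1 => //; exact: complex_borelI.
    by apply: HK2 => //; exact: complex_borelI.
  + by rewrite setDE setICA setICr setI0.
  + by exists f.
- exists (A `\` B, B) => _ _ /=; split=> //.
  + by rewrite setDE -setIA setICl setI0.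
  + exists f; have := EA f A bA (@subset_refl _ A).
    rewrite (setIidr BA) (setIidr (@subDsetl _ A B)) => EAf.
    have := rnormB (E A f) (E (A `\` B) f); have := AK f.
    by rewrite {2}EAf addrK; move: Bf; lra.
Qed.

(* A set inside which E is unbounded contains a set on which E is large and a
   disjoint set inside which E is still unbounded; iterating yields a disjoint
   sequence contradicting spectral_measure_disjoint_bounded. *)
Lemma spectral_measure_bounded :
  exists2 M : R, 0 < M & forall A f, complex_borel A -> rnorm (E A f) <= M * rnorm f.
Proof.
suff [M HM] : bounded_inside setT.
  exists (`|M| + 1) => [|A f bA]; first by have := normr_ge0 M; lra.
  apply: (le_trans (HM A bA _ f)) => //; rewrite ler_wpM2r ?rnorm_ge0//.
  by have := ler_norm M; lra.
apply: contrapT => uT.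
have [g gP] := choice (fun nA : nat * set R[i] => split_unbounded nA.1 nA.2).
(* [d n] is the decreasing sequence of sets still to be split, and [gamma n] below is the large
   piece cut off from [d n]; later pieces lie in [d n.+1], disjoint from [gamma n]. *)
pose d := fix d n := if n is m.+1 then (g (m, d m)).2 else setT.
have dP n : complex_borel (d n) /\ ~ bounded_inside (d n).
  elim: n => [|n [IHb IHu]] /=; first by split=> //; exact: complex_borelT.
  by have [[_ ?] ? _ _ _] := gP (n, d n) IHb IHu.
pose gamma n := (g (n, d n)).1.
have gammaP n := gP (n, d n) (dP n).1 (dP n).2.
have d_sub n m : (n <= m)%N -> d m `<=` d n.
  move=> /subnKC <-; elim: (m - n)%N => [|k IH]; first by rewrite addn0.
  by rewrite addnS; have [_ _ [_ ?] _ _] := gammaP (n + k)%N; apply: subset_trans IH.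
have gamma_disj n m : (n < m)%N -> gamma n `&` gamma m = set0.
  move=> nm; apply/seteqP; split=> // z [nz mz].
  have [_ _ _ disj _] := gammaP n; rewrite -disj; split=> //.
  have [_ _ [sub _] _ _] := gammaP m.
  by apply: (d_sub _ _ nm); exact: sub.
have [||K EK] := @spectral_measure_disjoint_bounded gamma.
- by move=> n; have [[]] := gammaP n.
- move=> n m _ _ [z [nz mz]].
  have [nm|mn|//] := ltngtP n m.
    by have : set0 z by rewrite -(gamma_disj _ _ nm).
  by have : set0 z by rewrite -(gamma_disj _ _ mn).
have Kn := le_lt_trans (ler_norm K) (archi_boundP (normr_ge0 K)).
set n := Num.bound _ in Kn.
have [_ _ _ _ [f]] := gammaP n; apply/negP; rewrite -leNgt.
by apply: (le_trans (EK n f)); rewrite ler_wpM2r ?rnorm_ge0// ltW.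
Qed.

End SpectralMeasure.
(** * Bounded integrals *)

Section ConvexCombinations.
Context {R : realType} {X : completeNormedModType R[i]}.

Lemma convex_rnorm_le (a : R) (y z : X) (L : R) :
  0 <= a <= 1 -> rnorm y <= L -> rnorm (y + z) <= L -> rnorm (y + a%:C *: z) <= L.
Proof.
move=> /andP[a0 a1] yL yzL.
have -> : y + a%:C *: z = (1 - a)%:C *: y + a%:C *: (y + z).
  by rewrite scalerDr addrA -scalerDl -rmorphD/= subrK scale1r.
apply: le_trans (rnormD _ _) _; rewrite !rnormZ !rnorm_real.
by rewrite !ger0_norm ?subr_ge0//; nra.
Qed.

(* The norm is convex, so on a cube it is largest at a vertex. *)
Lemma rnorm_sum_unit_interval (I : eqType) (x : I -> X) (s : seq I) (L : R)
    (y : X) (a : I -> R) :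
  uniq s -> (forall i, 0 <= a i <= 1) ->
  (forall P : pred I, rnorm (y + \sum_(i <- s | P i) x i) <= L) ->
  rnorm (y + \sum_(i <- s) (a i)%:C *: x i) <= L.
Proof.
move=> us a01; elim: s us y => [|i s IH] /=.
  by move=> _ y HP; have := HP predT; rewrite !big_nil.
move=> /andP[iNs us] y HP.
(* Since [i] is not in [s], forcing or forbidding [i] in the predicate leaves the sum over [s]
   unchanged; this supplies the two vertices with coordinate [i] equal to 0 and 1. *)
have neq j : j \in s -> (j == i) = false.
  by move=> js; apply/eqP => ji; rewrite -ji js in iNs.
rewrite big_cons addrA; apply: IH => // P.
rewrite addrAC; apply: convex_rnorm_le => //.
- have := HP (fun j => (j != i) && P j); rewrite big_cons eqxx/=.
  by rewrite big_seq_cond (eq_bigl (fun j => (j \in s) && P j)) -?big_seq_cond// => j;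
    case: (boolP (j \in s)) => //= /neq ->.
- have := HP (fun j => (j == i) || P j); rewrite big_cons eqxx/= addrAC addrA.
  by rewrite big_seq_cond (eq_bigl (fun j => (j \in s) && P j)) -?big_seq_cond// => j;
    case: (boolP (j \in s)) => //= /neq ->.
Qed.

End ConvexCombinations.

Section SimpleFunctions.
Context {R : realType} {X : completeNormedModType R[i]}.
Variables (E : set R[i] -> X -> X) (M : R).
Hypothesis Esm : spectral_measure E.
Hypothesis M0 : 0 < M.
Hypothesis EM : forall A f, complex_borel A -> rnorm (E A f) <= M * rnorm f.

(** After division by [K] the coefficients lie in the unit cube; at a vertex the sum is [E] of a
    union of some [delta i], hence bounded by [M]. *)
Let simple_nneg_bound (I : finType) (delta : I -> set R[i]) (a : I -> R) (K : R) f :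
  (forall i, complex_borel (delta i)) -> trivIset setT delta -> 0 < K ->
  (forall i, 0 <= a i <= K) ->
  rnorm (\sum_i (a i)%:C *: E (delta i) f) <= K * M * rnorm f.
Proof.
move=> bd dd K0 aK.
have -> : \sum_i (a i)%:C *: E (delta i) f =
    K%:C *: (0 + \sum_i (a i / K)%:C *: E (delta i) f).
  rewrite add0r scaler_sumr; apply: eq_bigr => i _.
  by rewrite scalerA -rmorphM/= mulrC divfK// gt_eqF.
rewrite rnormZ rnorm_real gtr0_norm// -mulrA ler_wpM2l ?(ltW K0)//.
apply: (rnorm_sum_unit_interval (x := fun i => E (delta i) f) (a := fun i => a i / K)).
  exact: index_enum_uniq.
  by move=> i; have /andP[? ?] := aK i; rewrite divr_ge0 ?(ltW K0)// ler_pdivrMr ?mul1r.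
move=> P; rewrite add0r -spectral_measure_bigsetU//; apply: EM.
exact: complex_borel_bigsetU.
Qed.

(** The factor 4 counts the positive and negative parts of the real and imaginary parts of the
    coefficients. *)
Lemma simple_bound (I : finType) (delta : I -> set R[i]) (c : I -> R[i]) (K : R) f :
  (forall i, complex_borel (delta i)) -> trivIset setT delta -> 0 < K ->
  (forall i z, delta i z -> rnorm (c i) <= K) ->
  rnorm (\sum_i c i *: E (delta i) f) <= 4 * M * K * rnorm f.
Proof.
move=> bd dd K0 cK.
(* The hypothesis says nothing about [c i] when [delta i] is empty, but then [E (delta i)] vanishes
   and [c i] may be replaced by 0. *)
wlog {cK}cK : c / forall i, rnorm (c i) <= K.
  move=> wl; pose c' i := if `[< exists z, delta i z >] then c i else 0.
  rewrite (eq_bigr (fun i => c' i *: E (delta i) f)).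
    apply: wl => i; rewrite /c'; case: asboolP => [iz|_]; last by rewrite rnorm0 ltW.
    by have [z] := iz; exact: cK.
  move=> i _; rewrite /c'; case: asboolP => // nz.
  have -> : delta i = set0 by apply/seteqP; split=> // z iz; apply: nz; exists z.
  by have [_ E0 _ _ _] := Esm; rewrite E0 !scaler0.
pose p (a : R) := Num.max a 0; pose n (a : R) := Num.max (- a) 0.
have pn a : a = p a - n a.
  by rewrite /p /n; case: (leP 0 a) => a0; case: leP; lra.
have part (b : I -> R) : (forall i, `|b i| <= K) ->
    rnorm (\sum_i (b i)%:C *: E (delta i) f) <= 2 * (K * M * rnorm f).
  move=> bK; rewrite (eq_bigr (fun i => (p (b i))%:C *: E (delta i) f
      - (n (b i))%:C *: E (delta i) f)); last first.
    by move=> i _; rewrite {1}(pn (b i)) rmorphB/= scalerBl.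
  rewrite big_split/= sumrN; apply: le_trans (rnormB _ _) _.
  rewrite mulr_natl mulr2n; apply: lerD; apply: simple_nneg_bound => // i.
    rewrite /p le_max lexx orbT ge_max (ltW K0) andbT.
    by apply: le_trans (bK i); exact: ler_norm.
  rewrite /n le_max lexx orbT ge_max (ltW K0) andbT.
  by apply: le_trans (bK i); rewrite -normrN; exact: ler_norm.
rewrite (eq_bigr (fun i => (complex.Re (c i))%:C *: E (delta i) f
    + 'i *: ((complex.Im (c i))%:C *: E (delta i) f))); last first.
  by move=> i _; rewrite {1}(complexE (c i)) scalerDl scalerA.
rewrite big_split/= -scaler_sumr; apply: le_trans (rnormD _ _) _; rewrite rnormZ.
have i1 : rnorm ('i : R[i]) = 1.
  by rewrite /rnorm normc_def/= expr0n expr1n add0r sqrtr1.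
have bRe i : `|complex.Re (c i)| <= K.
  apply: le_trans (cK i); rewrite -lecR -rnormE; exact: normc_ge_Re.
have bIm i : `|complex.Im (c i)| <= K.
  apply: le_trans (cK i); rewrite -lecR -rnormE.
  by have := normc_ge_Re (c i * 'i); rewrite ReiNIm normrN normrM (rnormE 'i) i1 mulr1.
rewrite i1; have := part _ bRe; have := part _ bIm; lra.
Qed.

End SimpleFunctions.
Section BoundedIntegral.
Context {R : realType} {X : completeNormedModType R[i]}.
Variables (E : set R[i] -> X -> X) (M : R).
Hypothesis Esm : spectral_measure E.
Hypothesis M0 : 0 < M.
Hypothesis EM : forall A f, complex_borel A -> rnorm (E A f) <= M * rnorm f.
Implicit Types (U V : set R[i]) (B C : X -> X) (f : X).

Let Ebounded A : complex_borel A -> bounded_operator (E A).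
Proof. by have [Eb _ _ _ _] := Esm; exact: Eb. Qed.

Let EI A A' f : complex_borel A -> complex_borel A' -> E (A `&` A') f = E A (E A' f).
Proof. by move=> bA bA'; have [_ _ _ EI _] := Esm; exact: EI. Qed.

Lemma bounded_integral_borel U F B : is_bounded_integral E U F B -> complex_borel U.
Proof.
move=> [_ /(_ _ ltr01)[n [c [delta [bd _ <- _ _]]]]].
rewrite (_ : \bigcup_i delta i = \big[setU/set0]_i delta i); last first.
  by rewrite -bigcup_seq; apply: eq_bigcupl; split=> i //= _; rewrite mem_index_enum.
exact: complex_borel_bigsetU.
Qed.

Lemma bounded_integral_simple U F B eps : is_bounded_integral E U F B -> 0 < eps ->
  exists (n : nat) (c : 'I_n -> R[i]) (delta : 'I_n -> set R[i]),
    [/\ forall i, complex_borel (delta i), trivIset setT delta, \bigcup_i delta i = U,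
        forall i z, delta i z -> rnorm (F z - c i) <= eps &
        forall f, rnorm (\sum_i c i *: E (delta i) f - B f) <= eps * rnorm f].
Proof.
move=> [_ HB] /HB[n [c [delta [bd dd dU cF cB]]]]; exists n, c, delta; split=> //.
  by move=> i z iz; rewrite -rnorm_le; exact: cF.
by move=> f; rewrite -lecR rmorphM/= -!rnormE; exact: cB.
Qed.

(** On the common refinement of the two approximating partitions, the coefficients on a nonempty
    cell are both close to a value of [F], so the two simple operators nearly agree once cut down to
    [U]. *)
Lemma bounded_integral_restrict U V F B C : is_bounded_integral E U F B ->
  is_bounded_integral E V F C -> U `<=` V -> forall f, B f = E U (C f).
Proof.
move=> iB iC UV f; have bU := bounded_integral_borel iB.
suff : rnorm (B f - E U (C f)) <= 0.
  move=> le0; apply/eqP; rewrite -subr_eq0 -normr_eq0 rnormE.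
  by apply/eqP; congr (_%:C); apply/eqP; rewrite eq_le le0 rnorm_ge0.
(* The three errors: [B f] against its simple sum, the two sums on the refinement
   ([4 * M * (2 * e)]), and [E U] applied to the error for [C f]. *)
apply: (le_eps0 (K := (1 + 8 * M + M) * rnorm f)) => e e0 _.
have [n [c [delta [bd dd dU cF cB]]]] := bounded_integral_simple iB e0.
have [m [c' [delta' [bd' dd' dV cF' cC]]]] := bounded_integral_simple iC e0.
pose D (p : 'I_n * 'I_m) := delta p.1 `&` delta' p.2.
have bD p : complex_borel (D p) by exact: complex_borelI.
have dD : trivIset setT D.
  move=> [i j] [i' j'] _ _ [z [[/= iz jz] [i'z j'z]]].
  by congr pair; [apply: dd|apply: dd'] => //; exists z.
have sB : \sum_i c i *: E (delta i) f = \sum_p c p.1 *: E (D p) f.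
  rewrite -(pair_bigA _ (fun i j => c i *: E (delta i `&` delta' j) f))/=.
  apply: eq_bigr => i _; rewrite -scaler_sumr -spectral_measure_cover//.
  by rewrite dV; apply: subset_trans UV; rewrite -dU; exact: bigcup_sup.
have diU i : delta i `<=` U by rewrite -dU; exact: bigcup_sup.
have sC : E U (\sum_j c' j *: E (delta' j) f) = \sum_p c' p.2 *: E (D p) f.
  rewrite -(pair_bigA _ (fun i j => c' j *: E (delta i `&` delta' j) f))/= exchange_big/=.
  rewrite bounded_operator_sum; last exact: Ebounded.
  apply: eq_bigr => j _; rewrite bounded_operatorZ; last exact: Ebounded.
  rewrite -scaler_sumr -EI// (spectral_measure_cover Esm (delta := delta))//.
  - congr (_ *: _); apply: eq_bigr => i _; congr (E _ f).
    by rewrite setIAC (setIidr (diU i)).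
  - exact: complex_borelI.
  - by rewrite dU; exact: subIsetl.
have cc' p z : D p z -> rnorm (c p.1 - c' p.2) <= 2 * e.
  move=> [iz jz]; have := rnorm_dist (c p.1) (F z) (c' p.2).
  by have := cF _ _ iz; have := cF' _ _ jz; rewrite (rnormBC (F z) (c p.1)); lra.
have e20 : 0 < 2 * e by lra.
have sBC := simple_bound Esm EM f bD dD e20 cc'.
have {sBC} ss' : rnorm (\sum_i c i *: E (delta i) f - E U (\sum_j c' j *: E (delta' j) f))
    <= 4 * M * (2 * e) * rnorm f.
  rewrite sB sC -sumrB; apply: le_trans sBC.
  by rewrite le_eqVlt; apply/orP; left; apply/eqP; congr rnorm;
    apply: eq_bigr => p _; rewrite scalerBl.
have := cB f; have := cC f; move: ss'; set s := \sum_i _; set s' := \sum_j _.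
move=> ss' sC' sB'.
have := rnorm_dist (B f) s (E U (C f)); rewrite (rnormBC (B f) s).
have := rnorm_dist s (E U s') (E U (C f)).
rewrite -(bounded_operatorB s' (C f) (Ebounded bU)).
have := EM (s' - C f) bU; have := ler_wpM2l (ltW M0) sC'.
lra.
Qed.

(** [E U f - f] is annihilated by [E A] for every Borel [A] inside [U], hence by every simple
    operator approximating [B]. *)
Lemma bounded_integral_idem U F B f : is_bounded_integral E U F B -> B (E U f) = B f.
Proof.
move=> iB; have bU := bounded_integral_borel iB.
have [bB _] := iB.
apply/eqP; rewrite -subr_eq0 -bounded_operatorB//; set g := E U f - f.
have Eg A : complex_borel A -> A `<=` U -> E A g = 0.
  move=> bA AU; rewrite bounded_operatorB; last exact: Ebounded.
  by rewrite -EI// (setIidl AU) subrr.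
suff : rnorm (B g) <= 0.
  by move=> le0; rewrite -normr_eq0 rnormE; apply/eqP; congr (_%:C); apply/eqP;
    rewrite eq_le le0 rnorm_ge0.
apply: (le_eps0 (K := rnorm g)) => e e0 _.
have [n [c [delta [bd dd dU cF cB]]]] := bounded_integral_simple iB e0.
have := cB g; rewrite big1 ?sub0r ?rnormN// => i _.
by rewrite Eg ?scaler0// -dU; exact: bigcup_sup.
Qed.

(* For a simple operator [s = \sum_i c i *: E (delta i)] split [s] according to
   whether [|c i| <= e]: the small part has norm O(e), and the other part is
   [s^2] followed by the simple operator with coefficients [1 / c i]. *)
Lemma bounded_integral_interpolation U B e f : is_bounded_integral E U id B -> 0 < e ->
  rnorm (B f) <= 4 * M * e * rnorm f + 4 * M / e * rnorm (B (B f)).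
Proof.
move=> iB e0; have [bB _] := iB; have [K K0 BK] := bounded_operatorP bB.
rewrite -subr_le0.
(* The first term pays for replacing [B f] by [s f], the second for replacing [s (s f)] by
   [B (B f)]. *)
apply: (le_eps0 (K := rnorm f + 4 * M / e * ((K + 1) * rnorm f + rnorm (B f)))) => h h0 h1.
have [n [c [delta [bd dd dU cF cB]]]] := bounded_integral_simple iB h0.
pose s g := \sum_i c i *: E (delta i) g.
pose phi i := if rnorm (c i) <= e then c i else 0.
pose psi i := if rnorm (c i) <= e then 0 else (c i)^-1.
have Es i g : E (delta i) (s g) = c i *: E (delta i) g.
  rewrite bounded_operator_sum; last exact: Ebounded.
  rewrite (bigD1 i)//= big1 ?addr0 => [|j ji].
    by rewrite bounded_operatorZ -?EI ?setIid//; exact: Ebounded.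
  rewrite bounded_operatorZ; last exact: Ebounded.
  have [_ E0 _ _ _] := Esm; rewrite -EI// (_ : _ `&` _ = set0) ?E0 ?scaler0//.
  apply/seteqP; split=> // z iz; apply/(negP ji)/eqP.
  by apply: dd => //; exists z; rewrite setIC.
have sE : s f = \sum_i phi i *: E (delta i) f + \sum_i psi i *: E (delta i) (s (s f)).
  rewrite -big_split/=; apply: eq_bigr => i _; rewrite !Es !scalerA -scalerDl.
  congr (_ *: _); rewrite /phi /psi; case: (leP (rnorm (c i)) e) => ci.
    by rewrite !mul0r addr0.
  rewrite add0r ?mulrA mulVf ?mul1r//.
  by apply/eqP => ci0; move: ci; rewrite ci0 rnorm0; lra.
have phiP : rnorm (\sum_i phi i *: E (delta i) f) <= 4 * M * e * rnorm f.
  apply: simple_bound => // i z _; rewrite /phi; case: (leP (rnorm (c i)) e) => // _.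
  by rewrite rnorm0 ltW.
have psiP : rnorm (\sum_i psi i *: E (delta i) (s (s f)))
    <= 4 * M / e * rnorm (s (s f)).
  apply: simple_bound => //; first by rewrite invr_gt0.
  move=> i z _; rewrite /psi; case: (leP (rnorm (c i)) e) => ci.
    by rewrite rnorm0 invr_ge0 ltW.
  by rewrite rnormV lef_pV2 ?posrE// ?ltW//; exact: lt_trans ci.
have sB g : rnorm (s g - B g) <= h * rnorm g := cB g.
have Bf : rnorm (B f) <= rnorm (s f) + h * rnorm f.
  by have := rnormB (s f) (s f - B f); rewrite subKr; have := sB f; lra.
have sf : rnorm (s f) <= rnorm (B f) + h * rnorm f.
  by have := rnormD (s f - B f) (B f); rewrite subrK; have := sB f; lra.
have ssf : rnorm (s (s f)) <= rnorm (B (s f)) + h * rnorm (s f).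
  by have := rnormD (s (s f) - B (s f)) (B (s f)); rewrite subrK; have := sB (s f); lra.
have Bsf : rnorm (B (s f)) <= K * (h * rnorm f) + rnorm (B (B f)).
  have := rnormD (B (s f) - B (B f)) (B (B f)); rewrite subrK -bounded_operatorB//.
  have := BK (s f - B f); have := ler_wpM2l (ltW K0) (sB f); lra.
have hh : h * (h * rnorm f) <= h * rnorm f.
  by rewrite ler_piMl// mulr_ge0 ?rnorm_ge0// ltW.
have {}ssf : rnorm (s (s f)) <= rnorm (B (B f)) + h * ((K + 1) * rnorm f + rnorm (B f)).
  by have := ler_wpM2l (ltW h0) sf; lra.
have sfle : rnorm (s f) <= 4 * M * e * rnorm f + 4 * M / e * rnorm (s (s f)).
  by rewrite {1}sE; apply: le_trans (rnormD _ _) _; exact: lerD.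
have q0 : 0 <= 4 * M / e by rewrite divr_ge0// ?mulr_ge0// ltW.
have := ler_wpM2l q0 ssf; move: sfle Bf; move: (4 * M / e) => q; lra.
Qed.

End BoundedIntegral.
(** * Compactness *)

Section Compactness.
Context {R : realType} {X : completeNormedModType R[i]}.
Implicit Types (S : X -> X) (f g : X).

(** [S] is the pointwise limit of its truncated integrals over [U n]. Each truncation is [E (U n)]
    after [S], so the inequality for truncations passes to the limit. *)
Lemma scalar_type_spectral_interpolation S : scalar_type_spectral setT S ->
  exists2 C : R, 0 < C & forall (e : R) f, 0 < e ->
    rnorm (S f) <= C * e * rnorm f + C / e * rnorm (S (S f)).
Proof.
move=> [_ _ _ [E [Esm _ _ iS]]].
have [M M0 EM] := spectral_measure_bounded Esm.
set U := fun n : nat => [set z | spectrum setT S z /\ `|id z| <= n%:R].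
have U_sub n m : (n <= m)%N -> U n `<=` U m.
  by move=> nm z [sz zn]; split=> //; apply: le_trans zn _; rewrite ler_nat.
(* The sequence [E (U n) (C m g)] equals [B g] for all [m >= n], and tends to [E (U n) (S g)]. *)
have ES n B g : is_bounded_integral E (U n) id B -> B g = E (U n) (S g).
  move=> iB; have bU := bounded_integral_borel iB.
  have [C [iC Cg]] := iS g Logic.I.
  have [Eb _ _ _ _] := Esm; have [_ cE] := Eb _ bU.
  have EC : E (U n) (C m g) @[m --> \oo] --> E (U n) (S g).
    exact: (cvg_comp _ _ Cg (cE (S g))).
  apply: norm_cvg_unique EC; apply: cvg_near_cst; exists n => // m /= nm.
  apply: esym; exact: (bounded_integral_restrict Esm M0 EM iB (iC m) (U_sub _ _ nm)).
(* One constant dominating both [4 * M] and [4 * M * M], the latter coming from [BBf] below. *)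
exists (4 * M * (1 + M)) => [|e f e0]; first by rewrite !mulr_gt0//; lra.
have [B [iB /cvg_rnorm Bf]] := iS f Logic.I.
have BBf n : rnorm (B n (B n f)) <= M * rnorm (S (S f)).
  rewrite (ES _ _ f (iB n)) (bounded_integral_idem Esm _ (iB n)) (ES _ _ _ (iB n)).
  by apply: EM; exact: bounded_integral_borel (iB n).
rewrite -subr_le0; apply: (le_eps0 (K := 1)) => h h0 _.
have [N _ HN] := Bf _ h0; have {HN} := HN N (leqnn _).
have := bounded_integral_interpolation Esm M0 EM f (iB N) e0.
have := rnormD (S f - B N f) (B N f); rewrite subrK.
have q0 : 0 <= 4 * M / e by rewrite divr_ge0// ?mulr_ge0// ltW.
have := ler_wpM2l q0 (BBf N).
have : 0 <= 4 * M * e * (M * rnorm f) by rewrite !mulr_ge0 ?rnorm_ge0// ltW.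
have : 0 <= 4 * M / e * rnorm (S (S f)) by rewrite mulr_ge0 ?rnorm_ge0.
rewrite (_ : 4 * M * (1 + M) / e = 4 * M / e * (1 + M)); last by rewrite mulrAC.
move: (4 * M / e) => q /=; lra.
Qed.

(* Precompactness of the image of the unit ball, with the finite cover encoded as
   a colouring k of the space. *)
Definition totally_bounded_operator S := forall rho : R, 0 < rho ->
  exists (n : nat) (k : X -> 'I_n), forall f g, rnorm f <= 1 -> rnorm g <= 1 ->
    k f = k g -> rnorm (S f - S g) <= rho.

(** A vector is coloured by the first ball of a finite cover, of radius [rho / 2], that contains its
    image. *)
Lemma compact_totally_bounded S : compact_operator S -> totally_bounded_operator S.
Proof.
move=> [_ Sc] rho rho0.
have r20 : 0 < rho / 2 by lra.
move: Sc; rewrite compact_cover => /(_ X setT (fun y => ball y (rho / 2)%:C)).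
case.
- by move=> y _; apply: ball_open; rewrite ltcR.
- by move=> y _; exists y => //; apply: ballxx; rewrite ltcR.
move=> D' _; move=> HD; pose D : seq X := finmap.enum_fset D'.
pose p f (y : X) := `[< rnorm (y - S f) < rho / 2 >].
(* [find] returns [size D] when no ball matches, as may happen outside the unit ball; the extra
   colour accommodates this value. *)
exists (size D).+1, (fun f => inord (find (p f) D)) => f g f1 g1 fg.
have hasp h : rnorm h <= 1 -> has (p h) D.
  move=> h1; have [|y yD yh] := HD (S h).
    by apply: subset_closure; exists h => //=; rewrite -[1]/(1%:C) rnorm_le.
  apply/hasP; exists y => //; apply/asboolP.
  by move: yh; rewrite -ball_normE/= rnorm_lt.
have fgE : find (p f) D = find (p g) D.
  have := congr1 val fg; rewrite /= !inordK// ltnS find_size//.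
have := nth_find 0 (hasp _ f1); have := nth_find 0 (hasp _ g1).
rewrite fgE => /asboolP yg /asboolP yf.
set y := nth _ _ _ in yf yg.
by have := rnorm_dist (S f) y (S g); rewrite (rnormBC (S f) y); lra.
Qed.

(** An ultrafilter on the closure contains one of finitely many small sets for each [e], so it is
    Cauchy and converges by completeness. *)
Lemma totally_bounded_compact S :
  bounded_operator S -> totally_bounded_operator S -> compact_operator S.
Proof.
move=> bS tS; split => //; rewrite compact_ultra => F FU FS.
have Fcauchy : cauchy F.
  apply/cauchy_exP => _ /gt0_complex[e e0 ->].
  have e40 : 0 < e / 4 by lra.
  have [n [k kP]] := tS _ e40.
  (* The images of each colour are thickened by [e / 4] so that the sets [A i] cover the closure and
     not only the image. *)
  pose A (i : 'I_n) :=
    [set y | exists f, [/\ rnorm f <= 1, k f = i & rnorm (y - S f) < e / 4]].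
  have [[i FAi]|nFA] := pselect (exists i, F (A i)).
    have [y [f [f1 kf yf]]] := @filter_ex _ _ _ _ FAi.
    exists y; apply: filterS FAi => z [g [g1 kg zg]].
    rewrite -ball_normE/= rnorm_lt.
    have := kP f g f1 g1 (etrans kf (esym kg)).
    have := rnorm_dist y (S f) z; have := rnorm_dist (S f) (S g) z.
    by rewrite (rnormBC (S g) z); lra.
  have FnA : \forall y \near F, forall i, (~` A i) y.
    apply: filter_forall => i.
    by have [FAi|//] := in_ultra_setVsetC (A i) FU; case: nFA; exists i.
  have [y [/(_ (ball y (e / 4)%:C))[]]] := filter_ex (filterI FS FnA).
    by apply: nbhsx_ballx; rewrite ltcR.
  move=> _ [[f f1 <-]]; rewrite -ball_normE/= rnorm_lt => yf /(_ (k f))[].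
  by exists f; split=> //; rewrite -rnorm_le.
have /cauchy_cvg/cvg_ex[y Fy] := Fcauchy.
exists y; split => //.
exact: (closed_cvg (u_ := id) _ (@closed_closure _ _) FS y Fy).
Qed.

Lemma totally_bounded_comp B S :
  bounded_operator B -> totally_bounded_operator S -> totally_bounded_operator (B \o S).
Proof.
move=> bB tS rho rho0; have [K K0 BK] := bounded_operatorP bB.
have [n [k kP]] := tS _ (divr_gt0 rho0 K0).
exists n, k => f g f1 g1 fg /=; rewrite -bounded_operatorB//.
by apply: le_trans (BK _) _; rewrite mulrC -ler_pdivlMr//; exact: kP.
Qed.

Lemma totally_bounded_sqrt S : bounded_operator S -> scalar_type_spectral setT S ->
  totally_bounded_operator (S \o S) -> totally_bounded_operator S.
Proof.
move=> bS sS tSS rho rho0.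
have [C C0 SC] := scalar_type_spectral_interpolation sS.
(* As [f - g] has norm at most 2, the first term is at most [rho / 2]; accuracy [e * e] for the
   square makes the second at most [C * e], that is [rho / 4]. *)
pose e := rho / (4 * C); have e0 : 0 < e by rewrite divr_gt0// mulr_gt0.
have [n [k kP]] := tSS _ (mulr_gt0 e0 e0).
exists n, k => f g f1 g1 fg; rewrite -bounded_operatorB//.
have := SC e (f - g) e0; rewrite !bounded_operatorB//.
have Ce : C * e = rho / 4 by rewrite /e; field; rewrite gt_eqF.
have : C / e * rnorm (S (S f) - S (S g)) <= C / e * (e * e).
  by apply: ler_wpM2l; [rewrite divr_ge0 ?ltW|exact: kP].
rewrite mulrA divfK ?gt_eqF// Ce.
have : rho / 4 * rnorm (f - g) <= rho / 4 * 2.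
  by apply: ler_wpM2l; [lra|have := rnormB f g; lra].
lra.
Qed.

End Compactness.

Theorem corollary5p2 (R : realType) (X : completeNormedModType R[i])
    (T : R -> X -> X) :
  ~ finite_dimensional X ->
  scalar_type_spectral_semigroup T ->
  eventually_compact T ->
  immediately_compact T.
Proof.
move=> _ [[Tb _ TD _] _ Ts] [t0 t00 Tt0] t t_gt0.
have s_ge0 n : 0 <= t0 / 2 ^+ n by rewrite divr_ge0// ?exprn_ge0// ltW.
have tb n : totally_bounded_operator (T (t0 / 2 ^+ n)).
  elim: n => [|n IH]; first by rewrite expr0 divr1; exact: compact_totally_bounded.
  apply: totally_bounded_sqrt (Tb _ (s_ge0 _)) (Ts _ (s_ge0 _)) _.
  rewrite (_ : _ \o _ = T (t0 / 2 ^+ n))//; apply/funext => f /=.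
  by rewrite -TD//; congr (T _ f); rewrite exprSr invfM mulrA [RHS]splitr.
(* Take [n] above [t0 / t] and use [n < 2 ^ n]. *)
have [n tn] : exists n, t0 / 2 ^+ n <= t.
  have := archi_boundP (divr_ge0 (ltW t00) (ltW t_gt0)); set n := Num.bound _ => tn.
  exists n; rewrite ler_pdivrMr ?exprn_gt0// mulrC -ler_pdivrMr//.
  by apply: le_trans (ltW tn) _; rewrite -natrX ler_nat ltnW// ltn_expl.
apply: totally_bounded_compact; first exact/Tb/ltW.
(* Total boundedness at the earlier time passes to [t] through the bounded left factor. *)
rewrite (_ : T t = T (t - t0 / 2 ^+ n) \o T (t0 / 2 ^+ n)).
  by apply: totally_bounded_comp => //; apply: Tb; rewrite subr_ge0.
by apply/funext => f /=; rewrite -TD ?subr_ge0// subrK.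
Qed.
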